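(* Let $G\le\mathrm{Aut}(T)$ be a finitely generated weakly branch group, and let $X$ be a minimal compact $G$-space on which $G$ acts faithfully. Assume that the orbital growth of the action satisfies $\mathrm{vol}_{G,X}(n)\preceq n^d$ for some $d\ge1$. Then there exists a continuous $G$-equivariant map $q:X\to\mathcal{F}(\partial T)$ with infinite image. In particular $X$ factors onto an infinite profinite $G$-space.
   Context: $T$ is a locally finite rooted tree, $\mathrm{Aut}(T)$ its root-fixing automorphisms, $\partial T$ its boundary. $G$ is weakly branch if $T$ is infinite and spherically homogeneous, $G$ is transitive on each level, and for every vertex $v$ the subgroup of elements acting trivially outside the subtree below $v$ is non-trivial. $\mathcal{F}(\partial T)$ is the space of closed subsets of $\partial T$ with the Hausdorff topology. For a finite symmetric generating set $S$, $\mathrm{vol}_{G,X}(n)=\sup_{x\in X}|B_S(n)\cdot x|$ with $B_S(n)$ the word-metric ball; $f\preceq g$ means $f(n)\le Cg(Cn)$ for some $C>0$. A $G$-space is profinite if it is an inverse limit of finite $G$-sets. *)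

(* Defs.v *)
From mathcomp Require Import all_boot.
From mathcomp Require Import boolp classical_sets functions cardinality topology.

Set Implicit Arguments.
Unset Strict Implicit.
Unset Printing Implicit Defensive.

Local Open Scope classical_set_scope.

(* The rooted tree T.  An infinite spherically homogeneous locally finite  *)
(* rooted tree is given (up to isomorphism) by its branching sequence      *)
(* m : nat -> nat with m i >= 1: vertices of level n are the sequences     *)
(* [:: x_0; ...; x_(n-1)] with x_i < m i; the root is [::]; the parent of  *)
(* a vertex is obtained by deleting its last letter.                       *)

Definition vertex (m : nat -> nat) (s : seq nat) : Prop :=
  forall i, (i < size s)%N -> (nth 0 s i < m i)%N.

Definition vmap := seq nat -> seq nat.

(* Root-fixing tree automorphisms, as maps on vertex labels, normalized to be
   the identity on sequences that are not vertices. Preserving prefixes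
   (take k) is preserving the tree structure (and fixes the root). *)
Definition is_tree_aut (m : nat -> nat) (f : vmap) : Prop :=
  [/\ (forall s, ~ vertex m s -> f s = s),
      (forall s, vertex m s -> vertex m (f s) /\ size (f s) = size s),
      (forall s k, vertex m s -> f (take k s) = take k (f s)),
      (forall s t, vertex m s -> vertex m t -> f s = f t -> s = t) &
      (forall t, vertex m t -> exists2 s, vertex m s & f s = t)].

Definition is_aut_subgroup (m : nat -> nat) (G : set vmap) : Prop :=
  [/\ G id,
      (forall g, G g -> is_tree_aut m g),
      (forall g h, G g -> G h -> G (g \o h)) &
      (forall g, G g -> exists2 h, G h & (h \o g = id /\ g \o h = id))].

Definition level_transitive (m : nat -> nat) (G : set vmap) : Prop :=
  forall u v, vertex m u -> vertex m v -> size u = size v ->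
    exists2 g, G g & g u = v.

Definition rist_nontrivial (m : nat -> nat) (G : set vmap) : Prop :=
  forall v, vertex m v ->
    exists2 g, G g & (g <> id /\ forall w, vertex m w -> ~~ prefix v w -> g w = w).

Definition weakly_branch (m : nat -> nat) (G : set vmap) : Prop :=
  [/\ (forall i, (0 < m i)%N), (* T infinite, spherically homogeneous *)
      is_aut_subgroup m G,
      level_transitive m G &
      rist_nontrivial m G].

Definition lin {A : Type} (x : A) (s : seq A) : Prop :=
  foldr (fun y P => y = x \/ P) False s.

Definition word_eval (w : seq vmap) : vmap := foldr (fun s acc => s \o acc) id w.

Definition finite_sym_gen (G : set vmap) (S : seq vmap) : Prop :=
  [/\ (forall s, lin s S -> G s),
      (forall s, lin s S -> exists2 t, lin t S & t \o s = id) &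
      (forall g, G g -> exists2 w, (forall s, lin s w -> lin s S) & g = word_eval w)].

Definition orbit_ball_le (X : Type) (act : vmap -> X -> X) (S : seq vmap)
    (n : nat) (x : X) (k : nat) : Prop :=
  exists l : seq X, (size l <= k)%N /\
    forall w, (size w <= n)%N -> (forall s, lin s w -> lin s S) ->
      lin (act (word_eval w) x) l.

Definition is_G_action (G : set vmap) (X : topologicalType) (act : vmap -> X -> X) : Prop :=
  [/\ act id = id,
      (forall g h, G g -> G h -> act (g \o h) = act g \o act h) &
      (forall g, G g -> continuous (act g))].

Definition faithful_action (G : set vmap) (X : Type) (act : vmap -> X -> X) : Prop :=
  forall g, G g -> (forall x, act g x = x) -> g = id.

Definition minimal_action (G : set vmap) (X : topologicalType) (act : vmap -> X -> X) : Prop :=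
  (exists x : X, True) /\ forall x : X, closure [set act g x | g in G] = [set: X].

(* The boundary and the space F(boundary) with the Hausdorff topology.     *)
(* Boundary points are rays xi : nat -> nat with xi i < m i.  We use the   *)
(* standard ultrametric d(xi,eta) = 2^-(length of common prefix).          *)

Definition in_boundary (m : nat -> nat) (xi : nat -> nat) : Prop :=
  forall i, (xi i < m i)%N.

Definition bact (g : vmap) (xi : nat -> nat) : nat -> nat :=
  fun i => nth 0 (g (mkseq xi i.+1)) i.

(* d(xi, eta) <= 2^-n *)
Definition agree (n : nat) (xi eta : nat -> nat) : Prop :=
  forall i, (i < n)%N -> xi i = eta i.

Definition closed_in_boundary (m : nat -> nat) (A : set (nat -> nat)) : Prop :=
  A `<=` in_boundary m /\
  forall xi, in_boundary m xi -> (forall n, exists2 a, A a & agree n a xi) -> A xi.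

(* Hausdorff distance between A and B is <= 2^-n *)
Definition hclose (n : nat) (A B : set (nat -> nat)) : Prop :=
  (forall a, A a -> exists2 b, B b & agree n a b) /\
  (forall b, B b -> exists2 a, A a & agree n a b).

Definition hausdorff_continuous (X : topologicalType) (q : X -> set (nat -> nat)) : Prop :=
  forall (x : X) (n : nat), \forall y \near x, hclose n (q x) (q y).

(* Main.v *)
Require Import Defs.
From mathcomp Require Import all_boot zify.
From mathcomp Require Import boolp classical_sets functions cardinality topology.

(** Write Rist(v) for the elements of G that are trivial outside the subtree
    T_v below v, and G_x for the stabilizer of x.

    Conjugates of an element of Rist(v) grow at least linearly, so products of
    d + 1 commuting families of conjugates give n^(d+1) elements of Rist(v) of
    length O(n). Polynomial growth of degree d thus yields a finite set P_v of
    non-trivial elements of Rist(v) such that every x is fixed by one of them: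
    the groups G_x are uniformly confined. A pigeonhole argument then finds,
    for all x and v, a vertex w below v and an r such that every a^e with a in
    Rist(w) and e divisible by r! coincides on T_w with an element of G_x.
    Combined with a non-trivial element of G_x in Rist(w), the double-commutator
    trick shows that G_x contains all [a^e, b^e] with a, b in Rist(u), for some
    u below w; if u is deep enough, e = |u|! is allowed.

    Say that v is moved at x if some [a^e, b^e] with a, b in Rist(v) and
    e = |v|! does not fix x, and let q(x) be the set of rays all of whose
    vertices are moved at x. Being moved is an open condition in x, and by
    minimality an open equivariant condition on the vertices of one level is
    locally constant; hence q is continuous. It has non-empty values because
    Rist(v) satisfies no law [a^e, b^e] = 1 and the action is faithful, and its
    values are nowhere dense by the previous paragraph. Finitely many of them
    cannot cover the boundary, whereas by transitivity on the levels all values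
    of q together are dense; so q has infinite image. *)

Set Implicit Arguments.
Unset Strict Implicit.
Unset Printing Implicit Defensive.

Local Open Scope classical_set_scope.

Lemma eq_at (A B : Type) (f g : A -> B) : f = g -> f =1 g. Proof. by move=> ->. Qed.

(** * Rigid stabilizers *)

Section WeaklyBranch.

Variables (m : nat -> nat) (G : set vmap).
Hypothesis branchG : weakly_branch m G.

Local Notation vertex := (vertex m).

(** The subgroup axioms only assert that an inverse exists, so one is chosen; the default [id] is
    met only outside [G]. *)
Definition vinv (g : vmap) : vmap :=
  xget (id : vmap) [set h | G h /\ (h \o g = id /\ g \o h = id)].

Lemma G_id : G id. Proof. by have [_ []] := branchG. Qed.

Lemma G_comp g h : G g -> G h -> G (g \o h).
Proof. by have [_ [_ _ GM _] _ _] := branchG; apply: GM. Qed.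

Lemma vinvP g : G g -> [/\ G (vinv g), cancel g (vinv g) & cancel (vinv g) g].
Proof.
have [_ [_ _ _ GV] _ _] := branchG => /GV [h Gh hP].
pose inverses := [set h | G h /\ (h \o g = id /\ g \o h = id)].
have [] := xgetPex (id : vmap) (ex_intro inverses h (conj Gh hP)).
rewrite -/(vinv g) => GV' [/eq_at E1 /eq_at E2].
by split.
Qed.

Lemma G_vinv g : G g -> G (vinv g). Proof. by case/vinvP. Qed.
Lemma vinvK g : G g -> cancel g (vinv g). Proof. by case/vinvP. Qed.
Lemma vinvKV g : G g -> cancel (vinv g) g. Proof. by case/vinvP. Qed.
Lemma G_inj g : G g -> injective g. Proof. by move/vinvK/can_inj. Qed.

Lemma G_iter n g : G g -> G (iter n g).
Proof. by move=> Gg; elim: n => [|n IHn]; [apply: G_id | apply: (G_comp Gg)]. Qed.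

Lemma vertexG g s : G g -> vertex s -> vertex (g s).
Proof.
by have [_ [_ Gaut _ _] _ _] := branchG => /Gaut [_ sz _ _ _] /sz [].
Qed.

Lemma sizeG g s : G g -> size (g s) = size s.
Proof.
have [_ [_ Gaut _ _] _ _] := branchG => /Gaut [idg sz _ _ _].
by have [/sz []|/idg ->] := pselect (vertex s).
Qed.

Lemma nvertexG g s : G g -> ~ vertex s -> g s = s.
Proof.
by have [_ [_ Gaut _ _] _ _] := branchG => /Gaut [idg _ _ _ _] /idg.
Qed.

Lemma takeG g s k : G g -> vertex s -> g (take k s) = take k (g s).
Proof.
by have [_ [_ Gaut _ _] _ _] := branchG => /Gaut [_ _ tk _ _]; apply: tk.
Qed.

Lemma vertex_take s k : vertex s -> vertex (take k s).
Proof.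
move=> vs i; rewrite size_take_min leq_min => /andP [ik iz].
by rewrite nth_take // vs.
Qed.

Lemma prefix_takel (u v : seq nat) : prefix u v -> take (size u) v = u.
Proof. by rewrite prefixE => /eqP. Qed.

Lemma prefixG g u v : G g -> vertex v -> prefix (g u) (g v) = prefix u v.
Proof.
move=> Gg vv; rewrite !prefixE sizeG // -takeG //.
by rewrite (inj_eq (G_inj Gg)).
Qed.

Lemma prefix_uniq (u v z : seq nat) :
  size u = size v -> prefix u z -> prefix v z -> u = v.
Proof. by rewrite !prefixE => -> /eqP <- /eqP. Qed.

Definition rist (v : seq nat) : set vmap :=
  [set g | G g /\ forall w, vertex w -> ~~ prefix v w -> g w = w].

Lemma rist_G v g : rist v g -> G g. Proof. by case. Qed.
Lemma rist_out v g z : rist v g -> ~~ prefix v z -> g z = z.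
Proof.
move=> [Gg out] nvz; have [vz|/(nvertexG Gg)//] := pselect (vertex z).
exact: out.
Qed.

Lemma rist_fix v g : rist v g -> g v = v.
Proof.
move=> rg; apply/eqP/negPn/negP => gv.
have /(rist_out rg) : ~~ prefix v (g v).
  by rewrite prefixE -(sizeG v (rist_G rg)) take_size.
by move/(G_inj (rist_G rg)); apply/eqP.
Qed.

Lemma rist_in v g z : rist v g -> prefix v (g z) = prefix v z.
Proof.
move=> rg; have [vz|nz] := pselect (vertex z).
  by rewrite -{1}(rist_fix rg) prefixG //; apply: rist_G rg.
by rewrite (nvertexG (rist_G rg) nz).
Qed.

Lemma rist_id v : rist v id. Proof. by split => //; apply: G_id. Qed.

Lemma rist_comp v g h : rist v g -> rist v h -> rist v (g \o h).
Proof.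
move=> rg rh; split; first exact: G_comp (rist_G rg) (rist_G rh).
by move=> w _ vw /=; rewrite (rist_out rh) // (rist_out rg).
Qed.

Lemma rist_iter v n g : rist v g -> rist v (iter n g).
Proof. by move=> rg; elim: n => [|n IHn]; [apply: rist_id | apply: (rist_comp rg)]. Qed.

Lemma rist_vinv v g : rist v g -> rist v (vinv g).
Proof.
move=> rg; split; first exact: G_vinv (rist_G rg).
by move=> w _ vw; rewrite -{1}(rist_out rg vw) (vinvK (rist_G rg)).
Qed.

Lemma rist_sub v w g : prefix v w -> rist w g -> rist v g.
Proof.
move=> vw rg; split=> [|z _ vz]; first exact: rist_G rg.
by apply: (rist_out rg); apply: contra vz; apply: prefix_trans.
Qed.

(** * Conjugation and disjoint supports *)

Definition vconj (g k : vmap) : vmap := g \o k \o vinv g.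

Lemma G_vconj g k : G g -> G k -> G (vconj g k).
Proof. by move=> Gg Gk; apply: G_comp; [apply: G_comp | apply: G_vinv]. Qed.

Lemma rist_vconj v g k : G g -> rist v k -> rist (g v) (vconj g k).
Proof.
move=> Gg rk; split=> [|z vz gvz]; first exact: G_vconj (rist_G rk).
rewrite /vconj /= (rist_out rk) ?vinvKV //.
by rewrite -(prefixG _ Gg) ?vinvKV //; apply: vertexG (G_vinv Gg) _.
Qed.

Lemma vconj_inj g : G g -> injective (vconj g).
Proof.
move=> Gg k l /eq_at E; apply/funext => z.
by have := E (g z); rewrite /vconj /= !vinvK // => /(G_inj Gg).
Qed.

Lemma vconj_comp g h k : G g -> G h -> vconj g (vconj h k) = vconj (g \o h) k.
Proof.
move=> Gg Gh; apply/funext => z; rewrite /vconj /=; congr (g (h (k _))).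
apply: (G_inj (G_comp Gg Gh)); rewrite vinvKV /=; last exact: G_comp.
by rewrite !vinvKV.
Qed.

Lemma vconj_id k : vconj id k = k.
Proof.
by apply/funext => z; rewrite /vconj /= -{2}[z](vinvKV G_id).
Qed.

Lemma iter_vconj n g k : G g -> iter n (vconj g k) = vconj g (iter n k).
Proof.
move=> Gg; apply/funext => z; rewrite /vconj /=.
by elim: n => [|n IHn]; rewrite /= ?vinvKV // IHn /vconj /= vinvK.
Qed.

Definition trivial_below (v : seq nat) (g : vmap) : Prop :=
  forall z, prefix v z -> g z = z.

Lemma rist_trivial u v g : size u = size v -> u <> v -> rist u g -> trivial_below v g.
Proof.
move=> uv neq rg z vz; apply: (rist_out rg).
by apply/negP => uz; apply: neq; apply: prefix_uniq uz vz.
Qed.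

(** Since [b] fixes the subtree below [v] pointwise, it preserves the complement, where [a] is
    trivial. *)
Lemma rist_commute v a b : rist v a -> G b -> trivial_below v b -> a \o b = b \o a.
Proof.
move=> ra Gb tb; apply/funext => z /=.
have [vz|nvz] := boolP (prefix v z).
  by rewrite (tb z vz) tb // (rist_in _ ra).
rewrite (rist_out ra nvz) (rist_out ra) //.
by apply: contra nvz => vbz; rewrite -(G_inj Gb (tb _ vbz)).
Qed.

Lemma rist_neq_id v g :
  rist v g -> g <> id -> exists2 u, vertex u & prefix v u /\ g u <> u.
Proof.
move=> rg gid; apply: contrapT => H; apply: gid; apply/funext => z.
have [vz|/(nvertexG (rist_G rg))//] := pselect (vertex z).
have [pz|/(rist_out rg)//] := boolP (prefix v z).
by apply: contrapT => gz; apply: H; exists z.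
Qed.

Lemma rist_nontriv v : vertex v -> exists2 g, rist v g & g <> id.
Proof.
have [_ _ _ rn] := branchG => /rn [g Gg [gid out]]; exists g => //.
Qed.

Lemma G_neq_id g : G g -> g <> id -> exists2 u, vertex u & g u <> u.
Proof.
move=> Gg gid; have rg : rist [::] g by split => // w _; rewrite prefix0s.
by have [u vu []] := rist_neq_id rg gid; exists u.
Qed.

(** Induction on [n]. Orbits can only lengthen on passing to descendants, so the critical case is
    that g^(n+1) is trivial below [u]. Composing [g] with a non-trivial [h] in [rist u] then makes
    the first return map to the subtree of [u] equal to [h], which moves some [u']. *)
Lemma long_orbit v n : vertex v ->
  exists2 g, rist v g &
    exists2 u, vertex u & prefix v u /\ forall i, 0 < i <= n -> iter i g u <> u.
Proof.
move=> vv; elim: n => [|n [g rg [u vu [pu orb]]]].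
  by exists id; [apply: rist_id | exists v => //; split => [|[]//]; exact: prefix_refl].
have [iu|iu] := pselect (iter n.+1 g u = u); last first.
  exists g => //; exists u => //; split => // i /andP[i0].
  by rewrite leq_eqVlt => /orP [/eqP -> //|]; rewrite ltnS => iLn; apply: orb; rewrite i0.
have take_iter i z : vertex z -> prefix u z -> take (size u) (iter i g z) = iter i g u.
  by move=> vz uz; rewrite -(takeG _ (G_iter i (rist_G rg))) // prefix_takel.
have [[u' vu' [uu' iu']]|none] :=
    pselect (exists2 u', vertex u' & prefix u u' /\ iter n.+1 g u' <> u').
  exists g => //; exists u' => //; split; first exact: prefix_trans uu'.
  move=> i /andP[i0]; rewrite leq_eqVlt => /orP [/eqP -> //|].
  rewrite ltnS => iLn E; apply: (orb i); first by rewrite i0.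
  by rewrite -(take_iter i u') // E prefix_takel.
have [h rh hid] := rist_nontriv vu.
have [u' vu' [uu' hu']] := rist_neq_id rh hid.
have vhu : vertex (h u') by apply: vertexG => //; apply: rist_G rh.
have uhu : prefix u (h u') by rewrite (rist_in _ rh).
(* For 0 < i <= n the i-th iterate lies below [iter i g u], which differs from [u]; so [h] acts in
   the first step only. *)
have iterE i : i <= n -> iter i.+1 (g \o h) u' = iter i.+1 g (h u').
  elim: i => [//|i IHi] iLn; rewrite iterS IHi; last exact: ltnW.
  by rewrite [RHS]iterS; apply: (congr1 g); apply: (rist_out rh);
     rewrite prefixE take_iter //; apply/eqP/orb; exact: iLn.
exists (g \o h); first by apply: rist_comp => //; apply: rist_sub rh.
exists u' => //; split; first exact: prefix_trans uu'.
case=> [//|i] /= iLn; rewrite -[g (h _)]/(iter i.+1 (g \o h) u') iterE //.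
rewrite leq_eqVlt in iLn; case/orP: iLn => [/eqP [->] E|iLn E].
  apply: hu'; rewrite -[RHS]E; apply: contrapT => E'; apply: none.
  by exists (h u') => //; split => //; apply: nesym.
apply: (orb i.+1) => //; rewrite -(take_iter i.+1 (h u')) // E.
exact: prefix_takel.
Qed.

(** Choose [a] with a^e u <> u, and [b] in [rist u] with b^e w <> w for some [w] below [u]. As a^e w
    is not below [u], b^e fixes it, and commuting would force b^e w = w. *)
Lemma rist_no_law v e : vertex v -> 0 < e ->
  exists2 a, rist v a & exists2 b, rist v b &
    iter e a \o iter e b <> iter e b \o iter e a.
Proof.
move=> vv e0; have [g rg [u vu [pu orb]]] := long_orbit e vv.
have gu : iter e g u <> u by apply: orb; rewrite e0 leqnn.
have [h rh [w vw [pw orbh]]] := long_orbit e vu.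
exists g => //; exists h; first exact: rist_sub rh.
move=> /eq_at /(_ w) /=; set A := iter e g; set B := iter e h.
have GA : G A by apply: G_iter; apply: rist_G rg.
rewrite [B (A w)](rist_out (rist_iter e rh)).
  by move/(G_inj GA); apply: orbh; rewrite e0 leqnn.
rewrite prefixE -takeG // prefix_takel //; exact/eqP.
Qed.

(** If [k] moves [z], take [g] in [rist z] with a long orbit at some [u] below [z] and conjugate [k]
    by its powers. Since [k u] is not below [z], powers of [g] fix it, and equality of the i-th and
    j-th conjugates would give g^(j-i) u = u. *)
Lemma conj_class_infinite k (l : seq vmap) : G k -> k <> id ->
  exists2 g, G g & vconj g k \notin l.
Proof.
move=> Gk kid; have [z vz kz] := G_neq_id Gk kid.
have [g rg [u vu [pu orb]]] := long_orbit (size l) vz.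
have Gg := rist_G rg; apply: contrapT => H.
pose s := mkseq (fun i => vconj (iter i g) k) (size l).+1.
suff us : uniq s.
  suff /(uniq_leq_size us) : {subset s <= l} by rewrite size_mkseq ltnn.
  move=> _ /mapP [i _ ->]; apply/negPn/negP => nl; apply: H.
  by exists (iter i g) => //; apply: G_iter.
have key i j : i < j -> j <= size l -> vconj (iter i g) k <> vconj (iter j g) k.
  move=> ij jl /eq_at E.
  have Gi := G_iter i Gg; have Gj := G_iter (j - i) Gg.
  have GN n : G (iter n g) := G_iter n Gg.
  have {E} := E (iter j g u); rewrite /vconj /= vinvK //.
  rewrite -{1 2}(subnKC (ltnW ij)) !iterD vinvK // => /(G_inj Gi).
  rewrite [RHS](rist_out (rist_iter _ rg)); last first.
    apply/negP => zku; apply: kz.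
    have : prefix (k z) (k u) by rewrite prefixG.
    by move=> /prefix_uniq; apply; rewrite ?sizeG.
  by move/(G_inj Gk); apply: orb; rewrite subn_gt0 ij (leq_trans (leq_subr _ _)).
rewrite map_inj_in_uniq ?iota_uniq // => i j; rewrite !mem_iota !add0n !ltnS /=.
by move=> il jl E; case: (ltngtP i j) => // /key; [case/(_ jl)|case/(_ il)].
Qed.

Lemma vinv_unique g h : G g -> h \o g = id -> h = vinv g.
Proof. by move=> Gg /eq_at E; apply/funext => z; rewrite -{1}(vinvKV Gg z) [LHS]E. Qed.

Lemma vinv_comp g h : G g -> G h -> vinv (g \o h) = vinv h \o vinv g.
Proof.
move=> Gg Gh; apply/esym/vinv_unique; first exact: G_comp.
by apply/funext => z /=; rewrite !vinvK.
Qed.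

Lemma vinv_id : vinv id = id.
Proof. by apply/esym/vinv_unique => //; apply: G_id. Qed.

Lemma vinvV g : G g -> vinv (vinv g) = g.
Proof.
move=> Gg; apply/esym/vinv_unique; first exact: G_vinv.
by apply/funext/vinvKV.
Qed.

Lemma branching v : vertex v -> exists u u',
  [/\ vertex u, vertex u', size u = size u', u <> u' & prefix v u /\ prefix v u'].
Proof.
move=> vv; have [g rg gid] := rist_nontriv vv.
have [u vu [pu gu]] := rist_neq_id rg gid; have Gg := rist_G rg.
exists u, (g u); rewrite sizeG // (rist_in _ rg).
by split=> //; [apply: vertexG | apply: nesym].
Qed.

(** * Levels of the tree and counting arguments *)

Fixpoint level n : seq (seq nat) :=
  if n is n'.+1 then [seq rcons s i | s <- level n', i <- iota 0 (m n')]
  else [:: [::]].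

Lemma mem_level n s : (s \in level n) <-> (vertex s /\ size s = n).
Proof.
elim: n s => [|n IHn] s /=.
  rewrite inE; split=> [/eqP ->|[_ /size0nil ->]//].
  by split=> // i.
split=> [/allpairsP [[t i] /= [/IHn [vt st]]]|].
  rewrite mem_iota add0n /= => im ->; split; last by rewrite size_rcons st.
  move=> j; rewrite size_rcons ltnS nth_rcons leq_eqVlt => /orP[/eqP ->|jt].
    by rewrite ltnn eqxx st.
  by rewrite jt vt.
case/lastP: s => [[]//|t i] []; rewrite size_rcons => vt [st].
apply/allpairsP; exists (t, i); split => //=; last first.
  by have := vt (size t); rewrite size_rcons nth_rcons ltnn eqxx mem_iota -st; apply.
apply/IHn; split => // j jt; have := vt j; rewrite size_rcons nth_rcons jt.
by apply; apply: ltnW.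
Qed.

Lemma uniq_level n : uniq (level n).
Proof.
elim: n => [//|n IHn] /=; apply: allpairs_uniq => //; first exact: iota_uniq.
by move=> [s i] [t j] _ _ /= /rcons_inj [-> ->].
Qed.

Lemma pigeonhole (A B : eqType) (R : B -> pred A) (V : seq B) (s : seq A) n :
  (forall a, a \in s -> exists2 b, b \in V & R b a) -> size V * n < size s ->
  exists2 b, b \in V & n < count (R b) s.
Proof.
elim: V s => [|b V IHV] s sV.
  by case: s sV => // a s /(_ a (mem_head _ _)) [].
have [nb _|bn /= sz] := ltnP n (count (R b) s); first by exists b => //; apply: mem_head.
have [a||b' b'V lt] := IHV [seq a <- s | ~~ R b a].
- rewrite mem_filter => /andP [nRb /sV [b']]; rewrite inE => /orP [/eqP ->|b'V R'].
    by rewrite (negPf nRb).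
  by exists b'.
- rewrite size_filter; have : count (R b) s + count (fun a => ~~ R b a) s = size s.
    exact: count_predC.
  by move: sz bn; rewrite mulSn; lia.
exists b'; first by rewrite inE b'V orbT.
apply: leq_trans lt _; rewrite count_filter; apply: sub_count => a /=.
by case/andP.
Qed.

Lemma uniform_bound (A : eqType) (s : seq A) (P : A -> nat -> Prop) :
  (forall a i j, i <= j -> P a i -> P a j) ->
  (forall a, a \in s -> exists i, P a i) -> exists i, forall a, a \in s -> P a i.
Proof.
move=> mono; elim: s => [|a s IHs] sP; first by exists 0.
have [|i Pi] := IHs.
  by move=> b bs; apply: sP; rewrite inE bs orbT.
have [j Pj] := sP a (mem_head a s).
exists (maxn i j) => b; rewrite inE => /orP [/eqP ->|/Pi].
  exact: mono (leq_maxr _ _) Pj.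
exact: mono (leq_maxl _ _).
Qed.

Lemma linP (T : eqType) (x : T) s : lin x s <-> x \in s.
Proof.
elim: s => [|y s IHs] //=; rewrite inE; split.
  by case=> [->|/IHs ->]; rewrite ?eqxx ?orbT.
by case/orP => [/eqP ->|/IHs]; [left | right].
Qed.

(** * Growth of rigid stabilizers *)

Section WordGrowth.

Variable S : seq vmap.
Hypothesis genS : finite_sym_gen G S.

Definition in_ball n g := exists2 w : seq vmap,
  size w <= n & (forall s, lin s w -> lin s S) /\ g = word_eval w.

Lemma gen_G s : lin s S -> G s. Proof. by have [SG _ _] := genS; apply: SG. Qed.

Lemma ball_G n g : in_ball n g -> G g.
Proof.
move=> [w _ [wS ->]]; elim: w wS => [|s w IHw] wS; first exact: G_id.
apply: G_comp; first by apply/gen_G/wS; left.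
by apply: IHw => t tw; apply: wS; right.
Qed.

Lemma ball_le n k g : n <= k -> in_ball n g -> in_ball k g.
Proof. by move=> nk [w wn wP]; exists w => //; apply: leq_trans nk. Qed.

Lemma ball_id n : in_ball n id. Proof. by exists [::]. Qed.

Lemma ball_gen s : lin s S -> in_ball 1 s.
Proof. by move=> sS; exists [:: s] => //; split => // t [<-|[]]. Qed.

Lemma ball_comp n k g h : in_ball n g -> in_ball k h -> in_ball (n + k) (g \o h).
Proof.
move=> [w wn [wS ->]] [u uk [uS ->]]; exists (w ++ u).
  by rewrite size_cat leq_add.
split=> [s /linP|]; first by rewrite mem_cat => /orP [/linP/wS|/linP/uS].
by elim: w {wn wS} => // s w /(congr1 (fun f => s \o f)).
Qed.

Lemma ball_vinv n g : in_ball n g -> in_ball n (vinv g).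
Proof.
have [_ symS _] := genS.
move=> [w wn [wS ->]]; apply: ball_le wn _.
elim: w wS => [|s w IHw] wS /=; first by rewrite vinv_id; apply: ball_id.
have sS : lin s S by apply: wS; left.
have {}IHw := IHw (fun t tw => wS t (or_intror tw)).
have Gw : G (word_eval w).
  by apply: (@ball_G (size w)); exists w => //; split => // t tw; apply: wS; right.
rewrite vinv_comp //; last exact: gen_G.
rewrite -[(size w).+1]addn1.
apply: ball_comp => //; have [t tS ts] := symS s sS.
by rewrite -(vinv_unique (gen_G sS) ts); apply: ball_gen.
Qed.

Lemma ball_conj n k g h : in_ball n g -> in_ball k h -> in_ball (n + k + n) (vconj g h).
Proof. by move=> bg bh; apply: ball_comp; [apply: ball_comp | apply: ball_vinv]. Qed.

Lemma ball_ex g : G g -> exists n, in_ball n g.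
Proof. by have [_ _ genG] := genS => /genG [w wS ->]; exists (size w), w. Qed.

(** A finite set of conjugates that is not closed under conjugation by generators gains an element
    when the radius grows by one; a closed one would contain the whole conjugacy class, which is
    infinite. *)
Lemma conj_growth k n : G k -> k <> id ->
  exists l, [/\ uniq l, size l = n.+1, k \in l &
    forall y, y \in l -> exists2 g, in_ball n g & y = vconj g k].
Proof.
move=> Gk kid; elim: n => [|n [l [ul sl kl lP]]].
  exists [:: k]; split => //; first exact: mem_head.
  by move=> y; rewrite inE => /eqP ->; exists id; [apply: ball_id | apply/esym/vconj_id].
have [[s sS [y yl nyl]]|stable] :=
    pselect (exists2 s, lin s S & exists2 y, y \in l & vconj s y \notin l).
  exists (vconj s y :: l); split; rewrite /= ?nyl ?sl ?inE ?kl ?orbT // => z.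
  rewrite inE => /orP [/eqP ->|/lP [g bg ->]]; last by exists g => //; apply: ball_le bg.
  have [g bg ->] := lP y yl; exists (s \o g); last first.
    by rewrite vconj_comp //; [apply: gen_G | apply: ball_G bg].
  by rewrite -add1n; apply: ball_comp => //; apply: ball_gen.
have [g Gg /negP[]] := conj_class_infinite l Gk kid.
have [_ _ genG] := genS; have [w wS ->] := genG g Gg.
elim: w wS => [|s w IHw] wS /=; first by rewrite vconj_id.
have sS : lin s S by apply: wS; left.
have {}wS t : lin t w -> lin t S by move=> tw; apply: wS; right.
have Gw : G (word_eval w) by apply: (@ball_G (size w)); exists w.
rewrite -vconj_comp //; last exact: gen_G.
apply: contrapT => /negP nyl; apply: stable; exists s => //.
by exists (vconj (word_eval w) k) => //; apply: IHw.
Qed.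

(* The conjugates of k by a ball are spread over finitely many rigid
   stabilizers of the level of v, so one of them receives a positive
   proportion; it is moved back to v by an element of bounded length. *)
Lemma rist_linear_growth v : vertex v -> exists c, forall n, exists l,
  [/\ uniq l, size l = n & forall g, g \in l -> rist v g /\ in_ball (c * n) g].
Proof.
have [_ _ trG _] := branchG.
move=> vv; have [k rk kid] := rist_nontriv vv.
have [c1 bk] := ball_ex (rist_G rk); pose V := level (size v).
have [c0 c0P] : exists i, forall u, u \in V -> exists2 t, in_ball i t & t u = v.
  apply: uniform_bound => [u i j ij [t bt tu]|u /mem_level [vu su]].
    by exists t => //; apply: ball_le bt.
  by have [t /ball_ex [i bt] tu] := trG u v vu vv su; exists i, t.
(* Conjugators of length at most [size V * n.+1] and [c0], applied to [k] of length at most [c1],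
   are counted twice each. *)
exists (2 * c0 + 2 * size V + c1) => -[|n]; first by exists [::].
have [l [ul sl _ lP]] := conj_growth (size V * n.+1) (rist_G rk) kid.
have [||u uV nu] := @pigeonhole _ _ (fun u g => `[< rist u g >]) V l n.+1.
- move=> y /lP [g bg ->]; exists (g v).
    by apply/mem_level; split; [apply: vertexG (ball_G bg) vv | apply: sizeG (ball_G bg)].
  by apply/asboolP/rist_vconj => //; apply: ball_G bg.
- by rewrite sl.
have [t bt tu] := c0P u uV; have Gt := ball_G bt.
exists (map (vconj t) (take n.+1 [seq g <- l | `[< rist u g >]])); split.
- rewrite map_inj_uniq; last exact: vconj_inj.
  by apply/take_uniq/filter_uniq.
- by rewrite size_map size_takel // size_filter ltnW.
move=> _ /mapP [g /mem_take gl ->]; move: gl.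
rewrite mem_filter => /andP [/asboolP rg /lP [h bh E]].
split; first by rewrite -tu; apply: rist_vconj.
rewrite E; apply: ball_le (ball_conj bt (ball_conj bh bk)); nia.
Qed.

(** Each further degree comes from two disjoint subtrees below [v]: the product of [a] in [rist u]
    and [b] in [rist u'] acts as [a] below [u], so it determines both factors. *)
Lemma rist_poly_growth D v : vertex v -> exists c, forall n, exists l,
  [/\ uniq l, size l = n ^ D & forall g, g \in l -> rist v g /\ in_ball (c * n) g].
Proof.
elim: D v => [|D IHD] v vv.
  exists 0 => n; exists [:: id]; split => // g; rewrite inE => /eqP ->.
  by split; [apply: rist_id | apply: ball_id].
have [u [u' [vu vu' su neq [pu pu']]]] := branching vv.
have [c1 c1P] := IHD u vu; have [c2 c2P] := rist_linear_growth vu'.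
exists (c1 + c2) => n; have [l1 [ul1 sl1 l1P]] := c1P n.
have [l2 [ul2 sl2 l2P]] := c2P n.
exists [seq a \o b | a <- l1, b <- l2]; split.
- apply: allpairs_uniq => // p p' /allpairsP [[a b] /= [/l1P [ra _] /l2P [rb _] ->]].
  move=> /allpairsP [[a' b'] /= [/l1P [ra' _] /l2P [rb' _] ->]] /= /eq_at E {p p'}.
  have tr b0 : rist u' b0 -> trivial_below u b0.
    by apply: rist_trivial => //; apply: nesym.
  have aa' : a = a'.
    apply/funext => z; have [uz|uz] := boolP (prefix u z).
      by have := E z; rewrite /= (tr b rb z uz) (tr b' rb' z uz).
    by rewrite (rist_out ra) // (rist_out ra').
  subst a'; congr pair; apply/funext => z.
  by have := E z => /= /(G_inj (rist_G ra)).
- by rewrite size_allpairs sl1 sl2 expnSr.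
move=> _ /allpairsP [[a b] /= [/l1P [ra ba] /l2P [rb bb] ->]]; split.
  by apply: rist_comp; [apply: rist_sub pu ra | apply: rist_sub pu' rb].
by rewrite mulnDl; apply: ball_comp.
Qed.

(** * Confinement of point stabilizers *)

Section Action.

Variables (X : topologicalType) (act : vmap -> X -> X) (d C : nat).
Hypothesis actG : is_G_action G act.
Hypothesis growth : forall (n : nat) (x : X),
  0 < n -> orbit_ball_le act S n x (C * (C * n) ^ d).

Lemma act_id x : act id x = x.
Proof. by have [-> _ _] := actG. Qed.

Lemma act_comp g h x : G g -> G h -> act (g \o h) x = act g (act h x).
Proof. by have [_ actM _] := actG => Gg Gh; rewrite actM. Qed.

Lemma actK g x : G g -> act (vinv g) (act g x) = x.
Proof.
move=> Gg; rewrite -act_comp //; last exact: G_vinv.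
by rewrite (_ : vinv g \o g = id) ?act_id //; apply/funext/vinvK.
Qed.

Lemma act_vinv_fix g x : G g -> act g x = x -> act (vinv g) x = x.
Proof. by move=> Gg gx; rewrite -{1}gx actK. Qed.

Lemma act_iter_fix n g x : G g -> act g x = x -> act (iter n g) x = x.
Proof.
move=> Gg gx; elim: n => [|n IHn]; first exact: act_id.
by rewrite -[iter n.+1 g]/(g \o iter n g) act_comp ?IHn //; apply: G_iter.
Qed.

(* Otherwise a product of d + 1 commuting families of linear growth would
   act injectively on the orbit of some x. *)
Lemma fixing_set v : vertex v -> exists P : seq vmap,
  (forall p, p \in P -> rist v p /\ p <> id) /\
  forall x, exists2 p, p \in P & act p x = x.
Proof.
move=> vv; have [c cP] := rist_poly_growth d.+1 vv.
(* With this [n], the number n^(d+1) of elements exceeds the growth bound at radius [c.+1 * n];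
   using [c.+1] in place of [c] keeps the radius positive. *)
pose n := (C * (C * c.+1) ^ d).+1; have [l [ul sl lP]] := cP n.
exists [seq p <- [seq vinv a \o b | a <- l, b <- l] | p != id :> vmap]; split.
  move=> p; rewrite mem_filter => /andP [/eqP pid /allpairsP [[a b] /= []]].
  move=> /lP [ra _] /lP [rb _] E; split=> //; rewrite E.
  by apply: rist_comp => //; apply: rist_vinv.
move=> x; apply: contrapT => none.
have inj : {in l &, injective (fun g => act g x)}.
  move=> a b al bl /= E; apply: contrapT => neq; apply: none.
  have [ra _] := lP a al; have [rb _] := lP b bl.
  have Ga := rist_G ra; have Gb := rist_G rb.
  exists (vinv a \o b); last by rewrite (act_comp _ (G_vinv Ga) Gb) -E actK.
  rewrite mem_filter; apply/andP; split; last by apply/allpairsP; exists (a, b).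
  apply/eqP => /eq_at E'; apply: neq; apply/funext => z.
  by rewrite -[b z](vinvKV Ga) [vinv a (b z)]E'.
have [//|L [sL LP]] := growth x (_ : 0 < c.+1 * n).
have sub : {subset [seq act g x | g <- l] <= L}.
  move=> _ /mapP [g /lP [_ [w wn [wS ->]]] ->]; apply/linP/LP => //.
  by apply: leq_trans wn _; rewrite leq_mul2r leqnSn orbT.
have := leq_trans (uniq_leq_size (_ : uniq [seq act g x | g <- l]) sub) sL.
rewrite map_inj_in_uniq // size_map sl => /(_ ul).
rewrite mulnA expnMn mulnA expnS leq_pmul2r ?expn_gt0 //.
by rewrite ltnn.
Qed.

(** * Vertices in general position *)

Definition pad L s := s ++ nseq (L - size s) 0.

Lemma size_pad L s : size s <= L -> size (pad L s) = L.
Proof. by move=> sL; rewrite size_cat size_nseq subnKC. Qed.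

Lemma prefix_pad L s : prefix s (pad L s).
Proof. exact: prefix_prefix. Qed.

Lemma vertex_pad L s : vertex s -> vertex (pad L s).
Proof.
have [m_gt0 _ _ _] := branchG.
move=> vs i _; rewrite nth_cat; case: ifP => [/vs //|_].
by rewrite nth_nseq; case: ifP.
Qed.

Lemma many_below v M : vertex v -> exists L0, forall L, L0 <= L ->
  exists l, [/\ uniq l, size l = M &
    forall w, w \in l -> [/\ vertex w, size w = L & prefix v w]].
Proof.
elim: M v => [|M IHM] v vv; first by exists 0 => L _; exists [::].
have [u [u' [vu vu' su neq [pu pu']]]] := branching vv.
have [L0 L0P] := IHM u vu; exists (maxn L0 (size u')) => L.
rewrite geq_max => /andP [/L0P [l [ul sl lP]] u'L].
exists (pad L u' :: l); rewrite /= ul sl andbT; split => //.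
  apply/negP => /lP [_ _ pp]; apply: neq.
  exact: prefix_uniq su pp (prefix_pad L u').
move=> w; rewrite inE => /orP [/eqP ->|/lP [vw sw uw]].
  split; [exact: vertex_pad | exact: size_pad |].
  exact: prefix_trans pu' (prefix_pad L u').
by split => //; apply: prefix_trans uw.
Qed.

Lemma many_moved p M : G p -> p <> id -> exists L0, forall L, L0 <= L ->
  exists l, [/\ uniq l, size l = M &
    forall w, w \in l -> [/\ vertex w, size w = L & p w <> w]].
Proof.
move=> Gp /(G_neq_id Gp) [z vz pz]; have [L0 L0P] := many_below M vz.
exists L0 => L /L0P [l [ul sl lP]]; exists l; split => // w /lP [vw sw zw].
split => // pw; apply: pz; rewrite -{1}(prefix_takel zw) takeG // pw.
exact: prefix_takel.
Qed.

(** Greedy choice on one deep level. A new vertex must be moved by p_j and avoid w_i, p_j w_i and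
    p_i^-1 w_i for all i < j, so a supply of 3 |P| + 1 vertices moved by p_j suffices. *)
Lemma separated_vertices (P : seq vmap) : (forall p, p \in P -> G p /\ p <> id) ->
  exists L, exists w : nat -> seq nat,
  [/\ forall j, j < size P -> vertex (w j) /\ size (w j) = L,
      forall i j, i < size P -> j < size P -> w i = w j -> i = j &
      forall i j, i < size P -> j < size P -> nth id P i (w j) <> w i].
Proof.
move=> PP; set p := nth id P.
have pP j : j < size P -> G (p j) /\ p j <> id by move=> jP; apply: PP; apply: mem_nth.
pose good q L := exists l, [/\ uniq l, size l = (3 * size P).+1 &
    forall w, w \in l -> [/\ vertex w, size w = L & (q : vmap) w <> w]].
have [L LP] : exists L, forall q, q \in P -> forall L', L <= L' -> good q L'.
  apply: uniform_bound => [q i j ij gi L' jL'|q /PP [Gq qid]].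
    by apply: gi; apply: leq_trans jL'.
  exact: many_moved.
exists L; have : forall k, k <= size P -> exists w : nat -> seq nat,
  [/\ forall j, j < k -> vertex (w j) /\ size (w j) = L,
      forall i j, i < k -> j < k -> w i = w j -> i = j &
      forall i j, i < k -> j < k -> p i (w j) <> w i].
  elim=> [|j IHj] jP; first by exists (fun=> [::]).
  have [w [vw inj sep]] := IHj (ltnW jP); have [Gp pid] := pP j jP.
  have [l [ul sl lP]] := LP (p j) (mem_nth (id : vmap) jP) L (leqnn L).
  pose F := map w (iota 0 j) ++ map (p j \o w) (iota 0 j) ++
            map (fun i => vinv (p i) (w i)) (iota 0 j).
  have [u ul' uF] : exists2 u, u \in l & u \notin F.
    apply: contrapT => none; have : size l <= size F.
      apply: uniq_leq_size => // u ul'; apply/negPn/negP => uF.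
      by apply: none; exists u.
    by rewrite sl !size_cat !size_map size_iota; lia.
  move: uF; rewrite !mem_cat !negb_or => /and3P [F1 F2 F3].
  have {}F1 i : i < j -> u <> w i.
    by move=> ij E; case/mapP: F1; exists i; rewrite ?mem_iota.
  have {}F2 i : i < j -> u <> p j (w i).
    by move=> ij E; case/mapP: F2; exists i; rewrite ?mem_iota.
  have {}F3 i : i < j -> p i u <> w i.
    move=> ij E; case/mapP: F3; exists i; rewrite ?mem_iota // -E vinvK //.
    by have [] := pP i (ltn_trans ij jP).
  have [vu su pu] := lP u ul'.
  exists (fun i => if i < j then w i else u); split => [i|i i'|i i'].
  - by move=> _; case: ifP => [/vw//|].
  - rewrite !ltnS => ij ij'; case: ltnP => lt; case: ltnP => lt'.
    + exact: inj.
    + by move/esym/F1; case.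
    + by move/F1; case.
    + by move=> _; apply/eqP; rewrite eqn_leq (leq_trans ij lt') (leq_trans ij' lt).
  - rewrite !ltnS => ij ij'; case: ltnP => lt; case: ltnP => lt'.
    + exact: sep.
    + have -> : i = j by apply/eqP; rewrite eqn_leq ij lt'.
      by apply: nesym; apply: F2.
    + exact: F3.
    + by have -> : i = j by apply/eqP; rewrite eqn_leq ij lt'.
by move/(_ (size P) (leqnn _)).
Qed.

Lemma iter_prefix n a v z : rist v a -> prefix v (iter n a z) = prefix v z.
Proof. by move=> ra; apply: (rist_in _ (rist_iter n ra)). Qed.

Lemma eq_iter_below w a b n z : rist w b -> (forall y, prefix w y -> a y = b y) ->
  prefix w z -> iter n a z = iter n b z.
Proof.
move=> rb ab wz; elim: n => [//|n IHn].
by rewrite !iterS IHn ab // iter_prefix.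
Qed.

Lemma disjoint_product (r L : nat) (w : nat -> seq nat) (a : nat -> vmap) :
  (forall j, j < r -> size (w j) = L /\ rist (w j) (a j)) ->
  (forall i j, i < r -> j < r -> w i = w j -> i = j) ->
  exists2 A, G A &
    (forall j z, j < r -> prefix (w j) z -> A z = a j z) /\
    (forall z, (forall j, j < r -> ~~ prefix (w j) z) -> A z = z).
Proof.
elim: r => [|r IHr] wa inj.
  by exists id; [apply: G_id | split => //].
have [||A GA [Ain Aout]] := IHr.
- by move=> j jr; apply: wa; apply: ltnW.
- by move=> i j ir jr; apply: inj; apply: ltnW.
have [swr rr] := wa r (ltnSn r).
have disj i z : i < r -> prefix (w i) z -> ~~ prefix (w r) z.
  move=> ir iz; apply/negP => rz; have [swi _] := wa i (ltnW ir).
  have /inj : w i = w r by apply: prefix_uniq iz rz; rewrite swi swr.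
  by move=> /(_ (ltnW ir) (ltnSn r)) E; rewrite E ltnn in ir.
exists (a r \o A); first exact: G_comp (rist_G rr) GA.
split=> [j z|z out] /=.
  rewrite ltnS leq_eqVlt => /orP [/eqP ->|jr] jz.
    rewrite Aout // => i ir; apply/negP => iz.
    by move: jz; rewrite (negPf (disj i z ir iz)).
  rewrite (Ain j) // (rist_out rr) //; apply: (disj j) => //.
  by have [_ rj] := wa j (ltnW jr); rewrite (rist_in _ rj).
rewrite Aout => [|j jr]; last exact/out/ltnW.
by rewrite (rist_out rr) // out.
Qed.

(* If no w_j worked, witnesses a_j would multiply to an element A, and two of
   the r + 1 points A^t x would be fixed by the same p_j; comparing them gives
   an element fixing x that acts on the subtree of w_j as a power of a_j. *)
Lemma powers_realized v x : vertex v -> exists r, exists2 w, vertex w /\ prefix v w &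
  forall a, rist w a -> exists2 i, 0 < i <= r &
    exists2 h, G h & act h x = x /\ forall z, prefix w z -> h z = iter i a z.
Proof.
move=> vv; have [P [PP fixP]] := fixing_set vv.
set r := size P; exists r; apply: contrapT => none.
have pP j : j < r -> rist v (nth id P j) /\ nth id P j <> id.
  by move=> jr; apply/PP/mem_nth.
have [|L [w [vw inj sep]]] := @separated_vertices P.
  by move=> p /PP [rp pid]; split; first exact: rist_G rp.
set p := nth id P in pP sep.
pose realized j a := exists2 i, 0 < i <= r &
  exists2 h, G h & act h x = x /\ forall z, prefix (w j) z -> h z = iter i a z.
have /choice [a aP] : forall j, exists a, j < r -> rist (w j) a /\ ~ realized j a.
  move=> j; apply: contrapT => na; have [jr|rj] := ltnP j r; last first.
    by apply: na; exists id; rewrite ltnNge rj.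
  (* The vertex [w j] is below [v] because [p j], an element of [rist v], moves it. *)
  apply: none; exists (w j).
    have [vwj _] := vw j jr; split => //; have [rp _] := pP j jr.
    by apply/negPn/negP => nv; apply: (sep j j jr jr); apply: rist_out nv.
  by move=> a ra; apply: contrapT => nr; apply: na; exists a.
have [||A GA [Ain Aout]] := @disjoint_product r L w a.
- by move=> j jr; have [_ sw] := vw j jr; have [ra _] := aP j jr.
- exact: inj.
have [||j jV] := @pigeonhole _ _ (fun j t => `[< act (p j) (act (iter t A) x) = act (iter t A) x >])
  (iota 0 r) (iota 0 r.+1) 1.
- move=> t _; have [q qP qx] := fixP (act (iter t A) x).
  exists (index q P); first by rewrite mem_iota index_mem.
  by apply/asboolP; rewrite /p nth_index.
- by rewrite !size_iota muln1.
have jr : j < r by move: jV; rewrite mem_iota.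
rewrite -size_filter; set s := seq.filter _ _ => s1.
have us : uniq s by apply/filter_uniq/iota_uniq.
have ss : sorted ltn s by apply/(sorted_filter ltn_trans)/iota_ltn_sorted.
have mem_s t : t \in s -> t <= r /\ act (p j) (act (iter t A) x) = act (iter t A) x.
  by rewrite mem_filter mem_iota add0n ltnS => /andP [/asboolP].
case: s s1 us ss mem_s => [|t [|t' s]] //= _ _ /andP [tt' _] mem_s.
have [_ fixt] := mem_s t (mem_head _ _).
have [|t'r fixt'] := mem_s t'; first by rewrite !inE eqxx orbT.
have [raj naj] := aP j jr; apply: naj; exists (t' - t).
  by rewrite subn_gt0 tt' (leq_trans (leq_subr _ _)).
have [rp _] := pP j jr; have Gp := rist_G rp.
set g := iter t A in fixt; set h := iter t' A in fixt'.
have Gg : G g by apply: G_iter.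
have Gh : G h by apply: G_iter.
have [GVg GVh GVp] := And3 (G_vinv Gg) (G_vinv Gh) (G_vinv Gp).
have G1 := G_comp GVp Gh; have G2 := G_comp GVh G1.
have G3 := G_comp Gg G2; have G4 := G_comp Gp G3.
(* A product of conjugates of [p j] and its inverse, each fixing [x]. Below [w j], the inner
   [vinv h] and [g] act on vertices where [A] is trivial, so only [h = A^t'] and the outer
   [vinv g = A^-t] have an effect. *)
exists (vinv g \o (p j \o (g \o (vinv h \o (vinv (p j) \o h))))).
  exact: G_comp GVg G4.
split.
  rewrite (act_comp _ GVg G4) (act_comp _ Gp G3) (act_comp _ Gg G2).
  rewrite (act_comp _ GVh G1) (act_comp _ GVp Gh).
  by rewrite (act_vinv_fix Gp fixt') (actK _ Gh) fixt actK.
move=> z wz; have [vz|nz] := pselect (vertex z); last first.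
  by rewrite /= !(nvertexG _ nz) //; apply: G_iter; apply: rist_G raj.
have iterA n y : prefix (w j) y -> iter n A y = iter n (a j) y.
  by move=> wy; apply: eq_iter_below wy => // y'; apply: Ain.
have iterA_out n y : (forall l, l < r -> ~~ prefix (w l) y) -> iter n A y = y.
  by move=> out; elim: n => //= n ->; apply: Aout.
rewrite /=; set y := h z; have hz : y = iter t' (a j) z by apply: iterA.
have wy : prefix (w j) y by rewrite hz iter_prefix.
have vy : vertex y by apply: vertexG.
(* Separation enters here: [p j (w l) <> w j], including the case l = j. *)
have out l : l < r -> ~~ prefix (w l) (vinv (p j) y).
  move=> lr; apply/negP; have vpy := vertexG GVp vy.
  rewrite -(prefixG _ Gp) // vinvKV // => pw; apply: (sep j l jr lr).
  have [_ swj] := vw j jr; have [_ swl] := vw l lr.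
  by apply: prefix_uniq pw wy; rewrite sizeG // swl.
have -> : vinv h (vinv (p j) y) = vinv (p j) y.
  by rewrite -{1}(iterA_out t' _ out) -/h vinvK.
rewrite /g iterA_out // vinvKV // hz -(subnKC (ltnW tt')) iterD.
by rewrite -iterA ?iter_prefix // vinvK // subnKC // ltnW.
Qed.

(** A conjugate of [n] by an element preserving the subtree of [w] depends only on the action there,
    so a^-1 n a = h^-1 n h, and the right-hand side fixes [x]. *)
Lemma agree_fixed w n a h x : rist w n -> rist w a -> G h ->
  (forall z, prefix w z -> h z = a z) -> act n x = x -> act h x = x ->
  act n (act a x) = act a x.
Proof.
move=> rn ra Gh ha nx hx.
have [Gn Ga] := (rist_G rn, rist_G ra); have GVh := G_vinv Gh.
have tw z : prefix w (h z) = prefix w z.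
  apply/idP/idP => [whz|wz]; last by rewrite ha // (rist_in _ ra).
  have E : h (vinv a (h z)) = h z.
    by rewrite ha ?vinvKV // (rist_in _ (rist_vinv ra)).
  by rewrite -(G_inj Gh E) (rist_in _ (rist_vinv ra)).
have E : n \o a = a \o (vinv h \o (n \o h)).
  apply/funext => z /=; have [wz|nwz] := boolP (prefix w z).
    rewrite ha //; have wnz : prefix w (n (a z)) by rewrite (rist_in _ rn) (rist_in _ ra).
    have -> : vinv h (n (a z)) = vinv a (n (a z)).
      apply: (G_inj Gh); rewrite vinvKV // ha ?vinvKV //.
      by rewrite (rist_in _ (rist_vinv ra)).
    by rewrite vinvKV.
  rewrite (rist_out ra nwz) (rist_out rn nwz) (rist_out rn) ?tw // vinvK //.
  by rewrite (rist_out ra nwz).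
have G1 := G_comp Gn Gh; have G2 := G_comp GVh G1.
rewrite -act_comp // E (act_comp _ Ga G2) (act_comp _ GVh G1) (act_comp _ Gn Gh).
by rewrite hx nx (act_vinv_fix Gh hx).
Qed.

(** The exponent |v|! is divisible by all positive i <= |v|, and it divides |w|! for [w] below [v],
    so that being moved passes to ancestors. *)
Definition moved x v := exists2 a, rist v a & exists2 b, rist v b &
  let e := (size v)`! in
  act (iter e a \o iter e b) x <> act (iter e b \o iter e a) x.

Lemma moved_nowhere_dense x v : vertex v ->
  exists2 w, vertex w /\ prefix v w & ~ moved x w.
Proof.
move=> vv; have [r [w [vw pvw] wP]] := powers_realized x vv.
have [P [PP fixP]] := fixing_set vw; have [n /PP [rn nid] nx] := fixP x.
have [u vu [wu nu]] := rist_neq_id rn nid.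
(* Depth at least [r] makes |u'|! a multiple of every exponent i <= r supplied by
   [powers_realized]. *)
pose u' := pad (maxn (size u) r) u.
have su' : size u' = maxn (size u) r by rewrite size_pad // leq_maxl.
have uu' : prefix u u' := prefix_pad _ u.
have vu' : prefix v u' := prefix_trans pvw (prefix_trans wu uu').
exists u'; first by split => //; apply: vertex_pad.
move=> [a ra [b rb]] /=; set e := (size u')`!; apply.
have Gn := rist_G rn.
have real c : rist u c -> exists2 h, G h &
    act h x = x /\ forall z, prefix w z -> h z = iter e c z.
  move=> rc; have rwc := rist_sub wu rc; have [i /andP [i0 ir] [h Gh [hx hc]]] := wP c rwc.
  have /dvdnP [q eq] : i %| e by apply: dvdn_fact; rewrite i0 su' (leq_trans ir) ?leq_maxr.
  exists (iter q h); first exact: G_iter.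
  split=> [|z wz]; first exact: act_iter_fix.
  rewrite eq iterM; apply: eq_iter_below (hc) wz; exact: rist_iter.
have ru c : rist u' c -> rist u c by apply: rist_sub.
have [h Gh [hx ha]] := real a (ru a ra); have [k Gk [kx kb]] := real b (ru b rb).
set A := iter e a in ha *; set B := iter e b in kb *.
have [rA rB] : rist u A /\ rist u B by split; apply: rist_iter; apply: ru.
have [rwA rwB] := (rist_sub wu rA, rist_sub wu rB).
have [GA GB] := (rist_G rA, rist_G rB).
have nA := agree_fixed rn rwA Gh ha nx hx.
have nB := agree_fixed rn rwB Gk kb nx kx.
have nAB : act n (act (A \o B) x) = act (A \o B) x.
  apply: (@agree_fixed w n _ (h \o k)) => //; try exact: rist_comp; try exact: G_comp.
    by move=> z wz /=; rewrite kb // ha // (rist_in _ rwB).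
  by rewrite (act_comp _ Gh Gk) kx.
(* Here [s] = n^-1 A n commutes with [B], their supports being below n^-1 u and [u], while [n] fixes
   x, Ax, Bx and ABx. Hence BAx = Bsx = sBx = n^-1 A n B x = n^-1 A B x = ABx. *)
pose s := vconj (vinv n) A; have Gs : G s by apply: G_vconj => //; apply: G_vinv.
have sE y : act s y = act (vinv n) (act A (act n y)).
  have GVn := G_vinv Gn; rewrite /s /vconj.
  rewrite (act_comp _ (G_comp GVn GA) (G_vinv GVn)) (act_comp _ GVn GA).
  by rewrite vinvV.
have sx : act s x = act A x by rewrite sE nx act_vinv_fix.
have sB : B \o s = s \o B.
  apply: (rist_commute rB Gs); apply: (@rist_trivial (vinv n u)).
  - by rewrite sizeG //; apply: G_vinv.
  - by move=> E; apply: nu; rewrite -{1}E vinvKV.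
  - by apply: rist_vconj => //; apply: G_vinv.
rewrite (act_comp _ GB GA) -sx -(act_comp _ GB Gs) sB (act_comp _ Gs GB) sE nB.
by rewrite -(act_comp _ GA GB) act_vinv_fix.
Qed.

Lemma moved_equiv g x v : G g -> moved x v -> moved (act g x) (g v).
Proof.
move=> Gg [a ra [b rb /= ne]]; exists (vconj g a); first exact: rist_vconj.
exists (vconj g b); first exact: rist_vconj.
rewrite /= sizeG // !iter_vconj //; move: ne; set e := _`!.
have GA : G (iter e a) := G_iter e (rist_G ra).
have GB : G (iter e b) := G_iter e (rist_G rb).
move: (iter e a) (iter e b) GA GB => A B GA GB ne E; apply: ne.
have actE k y : G k -> act (vconj g k) (act g y) = act g (act k y).
  by move=> Gk; rewrite (act_comp _ (G_comp Gg Gk) (G_vinv Gg)) actK // (act_comp _ Gg Gk).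
have GcA := G_vconj Gg GA; have GcB := G_vconj Gg GB.
move: E; rewrite (act_comp _ GcA GcB) (act_comp _ GcB GcA) !actE //.
move=> /(congr1 (act (vinv g))); rewrite !actK //.
by rewrite (act_comp _ GA GB) (act_comp _ GB GA).
Qed.

Lemma moved_sub v w x : prefix v w -> moved x w -> moved x v.
Proof.
move=> vw [a ra [b rb]] /= ne.
have /dvdnP [q eq] : (size v)`! %| (size w)`!.
  have le := size_prefix vw; rewrite -(subnKC le).
  elim: (size w - size v) => [|n IHn]; first by rewrite addn0.
  by rewrite addnS factS dvdn_mull.
exists (iter q a); first by apply/rist_iter/(rist_sub vw).
exists (iter q b); first by apply/rist_iter/(rist_sub vw).
move: ne; rewrite /= eq.
have iterE c : iter (q * (size v)`!) c = iter (size v)`! (iter q c) :> vmap.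
  by apply/funext => z; rewrite mulnC iterM.
by rewrite !iterE.
Qed.

(** * The factor map *)

Section Minimal.

Hypothesis hausX : hausdorff_space X.
Hypothesis faithX : faithful_action G act.
Hypothesis minX : minimal_action G act.

Lemma moved_open x v : moved x v -> \forall y \near x, moved y v.
Proof.
have [_ _ act_cont] := actG.
move=> [a ra [b rb /= /eqP ne]]; move: ne; set e := _`!.
have GA : G (iter e a) := G_iter e (rist_G ra).
have GB : G (iter e b) := G_iter e (rist_G rb) => ne.
have := hausX; rewrite open_hausdorff => /(_ _ _ ne) [[U V] /= []].
rewrite !inE => Ux Vx [oU oV UV].
have nU : \forall y \near x, U (act (iter e a \o iter e b) y).
  by apply: (act_cont _ (G_comp GA GB) x); apply: open_nbhs_nbhs.
have nV : \forall y \near x, V (act (iter e b \o iter e a) y).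
  by apply: (act_cont _ (G_comp GB GA) x); apply: open_nbhs_nbhs.
near=> y; exists a => //; exists b => //= E.
have : (U `&` V) (act (iter e a \o iter e b) y).
  by split; [near: y | rewrite E; near: y].
by rewrite UV.
Unshelve. all: by end_near. Qed.

(* In a minimal system a lower semicontinuous equivariant map to the subsets of
   a level is locally constant, because the cardinality of its values is
   constant along orbits. *)
Section Semicontinuous.

Variable P : X -> seq nat -> Prop.
Hypothesis P_open : forall x v, P x v -> \forall y \near x, P y v.
Hypothesis P_equiv : forall g x v, G g -> vertex v -> P x v -> P (act g x) (g v).

Let fiber n x := [seq v <- level n | `[< P x v >]].

Lemma fiber_subset_near n x : \forall y \near x, {subset fiber n x <= fiber n y}.
Proof.
suff H (s : seq (seq nat)) : \forall y \near x, forall v, v \in s -> P x v -> P y v.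
  have := H (level n); apply: filterS => y Py v.
  rewrite !mem_filter => /andP [/asboolP Pv vl]; rewrite vl andbT.
  exact/asboolP/Py.
elim: s => [|v s IHs]; first by apply: nearW.
have Pv : \forall y \near x, P x v -> P y v.
  by have [/P_open|nP] := pselect (P x v); [apply: filterS | apply: nearW].
near=> y.
have PPv : P x v -> P y v by near: y.
have PPs : forall w, w \in s -> P x w -> P y w by near: y.
by move=> w; rewrite inE => /orP [/eqP ->|/PPs].
Unshelve. all: by end_near. Qed.

Lemma fiber_orbit n g x : G g -> size (fiber n x) <= size (fiber n (act g x)).
Proof.
move=> Gg; rewrite -(size_map g (fiber n x)); apply: uniq_leq_size.
  by rewrite (map_inj_uniq (G_inj Gg)); apply/filter_uniq/uniq_level.
move=> _ /mapP [v vx ->]; move: vx.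
rewrite mem_filter => /andP [/asboolP Pv /mem_level [vv sv]].
rewrite mem_filter; apply/andP; split; first exact/asboolP/P_equiv.
by apply/mem_level; split; [apply: vertexG | rewrite sizeG].
Qed.

Lemma size_fiber n x y : size (fiber n x) = size (fiber n y).
Proof.
suff le x' y' : size (fiber n x') <= size (fiber n y').
  by apply/eqP; rewrite eqn_leq !le.
have [_ /(_ y') dense] := minX.
(* The orbit of [y'] meets the neighborhood of [x'] on which fibers contain that of [x'], and fiber
   sizes agree along an orbit. *)
have : closure [set act g y' | g in G] x' by rewrite dense.
move=> /(_ _ (fiber_subset_near n x')) [_ [[g Gg <-] sub]].
have : size (fiber n x') <= size (fiber n (act g y')).
  by apply: uniq_leq_size sub; apply/filter_uniq/uniq_level.
move=> /leq_trans; apply.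
by rewrite -{2}(actK y' Gg); apply: fiber_orbit; apply: G_vinv.
Qed.

Lemma fiber_locally_constant n x : \forall y \near x,
  forall v, v \in level n -> P y v <-> P x v.
Proof.
have := fiber_subset_near n x; apply: filterS => y sub v vl.
have ux : uniq (fiber n x) by apply/filter_uniq/uniq_level.
have [_ /(_ v)] := uniq_min_size ux sub (eq_leq (size_fiber n y x)).
rewrite !mem_filter vl !andbT => E.
by split=> [/asboolP|/asboolP]; [rewrite -E | rewrite E] => /asboolP.
Qed.

End Semicontinuous.

(** * Vertices with moved descendants on all levels *)

Definition reaches N x v := exists2 w, vertex w /\ size w = N & prefix v w /\ moved x w.

(** For vertices this amounts to lying on a ray of [ends x], by König's lemma. Being an infinite
    conjunction, it is not visibly open in [x], hence the approximations [reaches N]. *)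
Definition live x v := forall N, size v <= N -> reaches N x v.

Lemma reaches_open N x v : reaches N x v -> \forall y \near x, reaches N y v.
Proof.
by move=> [w vw [pw /moved_open]]; apply: filterS => y my; exists w.
Qed.

Lemma reaches_equiv N g x v : G g -> vertex v ->
  reaches N x v -> reaches N (act g x) (g v).
Proof.
move=> Gg vv [w [vw sw] [pw mw]]; exists (g w).
  by split; [apply: vertexG | rewrite sizeG].
by rewrite prefixG //; split => //; apply: moved_equiv.
Qed.

Lemma reaches_le N N' x v : size v <= N -> N <= N' -> reaches N' x v -> reaches N x v.
Proof.
move=> vN NN' [w [vw sw] [pw mw]]; exists (take N w).
  by split; [apply: vertex_take | rewrite size_takel // sw].
split; first by rewrite prefixE take_takel // prefix_takel.
by apply: moved_sub mw; apply: prefix_take.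
Qed.

Lemma live_moved x v : vertex v -> live x v -> moved x v.
Proof. by move=> vv /(_ _ (leqnn _)) [w _ [/moved_sub]]; apply. Qed.

(** The number of level-n vertices satisfying [reaches N x] is independent of [x] and non-increasing
    in N >= n. At an [N] where it is least the nested sets have stabilized, for all [x] at once. *)
Lemma live_stable n : exists2 N, n <= N &
  forall x v, v \in level n -> reaches N x v <-> live x v.
Proof.
have [[x0 _] _] := minX.
pose c N x := size [seq v <- level n | `[< reaches N x v >]].
have cE N x : c N x = c N x0.
  by apply: size_fiber; [apply: reaches_open | apply: reaches_equiv].
have [|k /asboolP [N nN cN] kmin] :=
    @ex_minnP (fun k => `[< exists2 N, n <= N & c N x0 = k >]).
  by exists (c n x0); apply/asboolP; exists n.
exists N => // x v vl; have [vv sv] := (mem_level n v).1 vl.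
split=> [rN M vM|]; last by apply; rewrite sv.
have [MN|/ltnW NM] := leqP M N; first exact: reaches_le MN rN.
have sub : {subset [seq v <- level n | `[< reaches M x v >]] <=
                   [seq v <- level n | `[< reaches N x v >]]}.
  move=> w; rewrite !mem_filter => /andP [/asboolP rM wl].
  rewrite wl andbT; apply/asboolP; apply: reaches_le NM rM.
  by have [_ ->] := (mem_level n w).1 wl.
have [||_ /(_ v)] := uniq_min_size _ sub.
- exact/filter_uniq/uniq_level.
- rewrite -/(c N x) -/(c M x) !cE cN; apply: kmin; apply/asboolP.
  by exists M => //; apply: leq_trans NM.
by rewrite !mem_filter vl !andbT => E; apply/asboolP; rewrite E; apply/asboolP.
Qed.

Lemma live_locally_constant n x : \forall y \near x,
  forall v, v \in level n -> live y v <-> live x v.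
Proof.
have [N _ NP] := live_stable n.
have := fiber_locally_constant (@reaches_open N) (@reaches_equiv N) n x.
by apply: filterS => y yx v vl; rewrite -!NP //; apply: yx.
Qed.

Lemma live_child x v : vertex v -> live x v ->
  exists2 i, i < m (size v) & live x (rcons v i).
Proof.
move=> vv lv; apply: contrapT => none.
have [M MP] : exists M, forall i, i \in iota 0 (m (size v)) ->
    (size v).+1 <= M /\ ~ reaches M x (rcons v i).
  apply: uniform_bound => [i j k jk [vj nj]|i].
    split; first exact: leq_trans jk.
    by apply: contra_not nj; apply: reaches_le; rewrite ?size_rcons.
  rewrite mem_iota add0n /= => im; apply: contrapT => nM; apply: none.
  exists i => // N; rewrite size_rcons => vN; apply: contrapT => nr.
  by apply: nM; exists N.
(* The maximum ensures that [w] properly extends [v] and so passes through a child. *)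
have [w [vw sw] [pw mw]] := lv (maxn M (size v).+1) (leq_trans (leqnSn _) (leq_maxr _ _)).
have vw1 : size v < size w by rewrite sw leq_maxr.
have im : nth 0 w (size v) < m (size v) by apply: vw.
have [|vM] := MP (nth 0 w (size v)); first by rewrite mem_iota.
apply; exists w; first by rewrite sw (maxn_idPl vM).
split=> //; rewrite prefixE size_rcons (take_nth 0) //.
by rewrite prefix_takel.
Qed.

(** * The closed set of rays attached to a point *)

Definition ends x : set (nat -> nat) :=
  [set xi | in_boundary m xi /\ forall n, moved x (mkseq xi n)].

Lemma vertex_mkseq xi n : in_boundary m xi -> vertex (mkseq xi n).
Proof. by move=> bxi i; rewrite size_mkseq => ?; rewrite nth_mkseq. Qed.

Lemma take_mkseq (xi : nat -> nat) k n : k <= n -> take k (mkseq xi n) = mkseq xi k.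
Proof. by move=> kn; rewrite -map_take take_iota (minn_idPl kn). Qed.

Lemma mkseq_agree n (xi eta : nat -> nat) : mkseq xi n = mkseq eta n <-> agree n xi eta.
Proof.
split=> [E i il|E]; first by rewrite -(nth_mkseq 0 xi il) E nth_mkseq.
by apply/eq_in_map => i; rewrite mem_iota => /E.
Qed.

Lemma ends_live x xi n : ends x xi -> live x (mkseq xi n).
Proof.
move=> [bxi mxi] N; rewrite size_mkseq => nN; exists (mkseq xi N).
  by rewrite size_mkseq; split => //; apply: vertex_mkseq.
by rewrite prefixE size_mkseq take_mkseq.
Qed.

Lemma live_ends x v : vertex v -> live x v ->
  exists2 xi, ends x xi & mkseq xi (size v) = v.
Proof.
move=> vv lv.
have /choice [next nextP] : forall u, exists i, vertex u -> live x u ->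
    i < m (size u) /\ live x (rcons u i).
  move=> u; have [[vu lu]|nu] := pselect (vertex u /\ live x u).
    by have [i im li] := live_child vu lu; exists i.
  by exists 0 => vu lu; case: nu.
pose f k := iter k (fun u => rcons u (next u)) v.
have fP k : [/\ vertex (f k), live x (f k) & size (f k) = size v + k].
  elim: k => [|k [vf lf sf]]; first by rewrite addn0.
  have [im lf'] := nextP _ vf lf; split => //.
    move=> i; rewrite size_rcons ltnS nth_rcons leq_eqVlt.
    by case/orP => [/eqP ->|il]; rewrite ?ltnn ?eqxx // il; apply: vf.
  by rewrite /= size_rcons sf addnS.
have fpre k l : prefix (f k) (f (k + l)).
  elim: l => [|l IHl]; first by rewrite addn0 prefix_refl.
  by rewrite addnS; apply: prefix_trans IHl (prefix_rcons _ _).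
have fnth k l i : k <= l -> i < size (f k) -> nth 0 (f l) i = nth 0 (f k) i.
  move=> kl il; rewrite -(subnKC kl) -(prefix_takel (fpre k (l - k))).
  by rewrite nth_take.
(* As [f i.+1] has length [size v + i.+1], the default 0 is never read. *)
pose xi i := nth 0 (f i.+1) i.
have xiE n : mkseq xi n = take n (f n).
  have [_ _ sf] := fP n; apply: (@eq_from_nth _ 0).
    by rewrite size_mkseq size_takel // sf leq_addl.
  move=> i; rewrite size_mkseq => il; rewrite nth_mkseq // nth_take //.
  have [_ _ sfi] := fP i.+1; apply/esym/fnth => //.
  by rewrite sfi addnS ltnS leq_addl.
exists xi; last first.
  by rewrite xiE prefix_takel //; apply: (fpre 0).
split=> [i|n].
  have [vf _ sf] := fP i.+1; apply: vf.
  by rewrite sf addnS ltnS leq_addl.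
have [vf lf _] := fP n; rewrite xiE.
by apply: moved_sub (live_moved vf lf); apply: prefix_take.
Qed.

Lemma mkseq_bact g xi n : G g -> in_boundary m xi ->
  mkseq (bact g xi) n = g (mkseq xi n).
Proof.
move=> Gg bxi; apply: (@eq_from_nth _ 0); first by rewrite sizeG // !size_mkseq.
move=> i; rewrite size_mkseq => il; rewrite nth_mkseq // /bact.
rewrite -(take_mkseq xi il) takeG; last exact: vertex_mkseq.
  by rewrite nth_take.
by [].
Qed.

Lemma bact_boundary g xi : G g -> in_boundary m xi -> in_boundary m (bact g xi).
Proof.
move=> Gg bxi i; have : vertex (mkseq (bact g xi) i.+1).
  by rewrite mkseq_bact //; apply: vertexG => //; apply: vertex_mkseq.
by move/(_ i); rewrite size_mkseq nth_mkseq //; apply.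
Qed.

Lemma ends_bact g x xi : G g -> ends x xi -> ends (act g x) (bact g xi).
Proof.
move=> Gg [bxi mxi]; split=> [|n]; first exact: bact_boundary.
by rewrite mkseq_bact //; apply: moved_equiv.
Qed.

Lemma ends_equiv g x : G g -> ends (act g x) = bact g @` ends x.
Proof.
move=> Gg; apply/seteqP; split=> [eta eeta|_ [xi exi <-]]; last exact: ends_bact.
have GV := G_vinv Gg; have := ends_bact GV eeta; rewrite actK // => exi.
have [beta _] := eeta; exists (bact (vinv g) eta) => //.
apply/funext => i; have /mkseq_agree : mkseq (bact g (bact (vinv g) eta)) i.+1 = mkseq eta i.+1.
  by rewrite !mkseq_bact ?vinvKV //; apply: bact_boundary.
by apply.
Qed.

Lemma ends_closed x : closed_in_boundary m (ends x).
Proof.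
split=> [xi []//|xi bxi app]; split=> // n.
by have [a [_ ma] /mkseq_agree <-] := app n.
Qed.

(** Up to Hausdorff distance 2^-n the set [ends x] is determined by the live vertices of level n,
    which are locally constant in [x]. *)
Lemma ends_continuous : hausdorff_continuous ends.
Proof.
move=> x n; have := live_locally_constant n x; apply: filterS => y yx.
have transfer x' y' : (forall v, v \in level n -> live x' v -> live y' v) ->
    forall a, ends x' a -> exists2 b, ends y' b & agree n a b.
  move=> xy a ea; have va : vertex (mkseq a n) by apply: vertex_mkseq; case: ea.
  have [|b eb E] := @live_ends y' (mkseq a n) va.
    by apply: xy; [apply/mem_level; rewrite size_mkseq | apply: ends_live].
  by exists b => //; apply/mkseq_agree; rewrite -E !size_mkseq.
split=> [a|b eb]; first by apply: transfer => v vl; apply: (yx v vl).2.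
have [|a ea ab] := transfer y x _ b eb; first by move=> v vl; apply: (yx v vl).1.
by exists a => // i il; rewrite ab.
Qed.

(** It suffices that the root is live. By [rist_no_law] and faithfulness some vertex of level [N] is
    moved at some [y]; counting on level 0, whose only vertex is the root, transfers this from [y]
    to [x]. *)
Lemma ends_nonempty x : exists xi, ends x xi.
Proof.
have [N _ NP] := live_stable 0.
have [m_gt0 _ _ _] := branchG.
have vw : vertex (nseq N 0) by move=> i _; rewrite nth_nseq; case: ifP.
have [a ra [b rb ab]] := rist_no_law vw (fact_gt0 (size (nseq N 0))).
have [y my] : exists y, moved y (nseq N 0).
  apply: contrapT => none; apply: ab; set e := _`! in none *.
  have GA : G (iter e a) := G_iter e (rist_G ra).
  have GB : G (iter e b) := G_iter e (rist_G rb).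
  have GAB := G_comp GA GB; have GBA := G_comp GB GA.
  suff /eq_at E : vinv (iter e b \o iter e a) \o (iter e a \o iter e b) = id.
    apply/funext => z; rewrite -[LHS](vinvKV GBA); congr (iter e b (iter e a _)).
    exact: E.
  apply: faithX; first exact: G_comp (G_vinv GBA) GAB.
  move=> z; rewrite (act_comp _ (G_vinv GBA) GAB).
  suff -> : act (iter e a \o iter e b) z = act (iter e b \o iter e a) z by rewrite actK.
  by apply: contrapT => ne; apply: none; exists z, a => //; exists b.
have ry : reaches N y [::].
  by exists (nseq N 0); rewrite ?size_nseq ?prefix0s.
have lx : live x [::].
  apply/NP => //; have E := size_fiber (@reaches_open N) (@reaches_equiv N) 0 x y.
  move: E => /=; rewrite (asboolT ry) /=; case: asboolP => //.
by have [||xi exi _] := @live_ends x [::]; [| |exists xi].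
Qed.

Lemma ends_infinite : ~ finite_set (range ends).
Proof.
have [_ _ trG _] := branchG; have [[x0 _] _] := minX.
move=> /finite_seqP [s sE].
(* Finitely many nowhere dense sets are avoided one after the other by descending in the tree. *)
have avoid (t : seq (set (nat -> nat))) v : {subset t <= s} -> vertex v ->
    exists2 w, vertex w /\ prefix v w &
      forall F xi, F \in t -> F xi -> mkseq xi (size w) <> w.
  elim: t v => [|F t IHt] v ts vv; first by exists v => //; split => //; apply: prefix_refl.
  have [|w [vw pvw] wP] := IHt v _ vv; first by move=> H Ht; apply: ts; rewrite inE Ht orbT.
  have [x _ xF] : range ends F.
    by rewrite sE /=; apply: ts; apply: mem_head.
  have [w' [vw' pw'] nm] := moved_nowhere_dense x vw.
  exists w'; first by split=> //; apply: prefix_trans pw'.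
  move=> F' xi; rewrite inE => /orP [/eqP ->|F't] F'xi E.
    by apply: nm; move: F'xi; rewrite -xF => -[_ /(_ (size w'))]; rewrite E.
  apply: (wP F' xi F't F'xi).
  by rewrite -(take_mkseq xi (size_prefix pw')) E prefix_takel.
have [xi exi] := ends_nonempty x0; have [bxi _] := exi.
have [|w [vw _] wP] := @avoid s [::] (fun _ => id); first by [].
(* Level transitivity carries a ray of [ends x0] to one through the avoided vertex [w], and this ray
   lies in the value at [act g x0]. *)
have [|g Gg gw] := trG (mkseq xi (size w)) w (vertex_mkseq bxi) vw; first exact: size_mkseq.
apply: (wP (ends (act g x0)) (bact g xi)).
- have : range ends (ends (act g x0)) by exists (act g x0).
  by rewrite sE.
- exact: ends_bact.
by rewrite mkseq_bact.
Qed.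

End Minimal.
End Action.
End WordGrowth.
End WeaklyBranch.

Theorem theorem6p9 (m : nat -> nat) (G : set vmap) (S : seq vmap)
  (X : topologicalType) (act : vmap -> X -> X) (d : nat) :
  weakly_branch m G ->
  finite_sym_gen G S ->
  compact [set: X] -> hausdorff_space X ->
  is_G_action G act -> faithful_action G act -> minimal_action G act ->
  (1 <= d)%N ->
  (exists2 C : nat, (0 < C)%N &
     forall (n : nat) (x : X), (0 < n)%N -> orbit_ball_le act S n x (C * (C * n) ^ d)) ->
  exists q : X -> set (nat -> nat),
    [/\ (forall x, closed_in_boundary m (q x)),
        hausdorff_continuous q,
        (forall g x, G g -> q (act g x) = bact g @` q x) &
        ~ finite_set (range q)].
Proof.
move=> branchG genS _ hausX actG faithX minX _ [C _ growth].
exists (ends m G act); split.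
- exact: ends_closed.
- exact: (ends_continuous branchG actG hausX minX).
- by move=> g x; apply: (ends_equiv branchG actG).
- exact: (ends_infinite branchG genS actG growth hausX faithX minX).
Qed.
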